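(* Let $\mathcal{M}\subset B(\mathcal{H})$ be a unital operator space. If $\{\pi_i:C^*(\mathcal{M})\rightarrow B(\mathcal{H}_i):i\in I\}$ is a collection of $*$-representations that possess the approximate unique extension property with respect to $\mathcal{M}$, then $\pi=\bigoplus_{i\in I}\pi_i$ also possesses the approximate unique extension property with respect to $\mathcal{M}$.
   Context: A unital operator space is a linear subspace $\mathcal{M}\subset B(\mathcal{H})$, $\mathcal{H}$ a Hilbert space, containing the identity; $C^*(\mathcal{M})\subset B(\mathcal{H})$ is the $C^*$-algebra it generates. $*$-representations of unital $C^*$-algebras are on Hilbert spaces and are unital. A $*$-representation $\pi:C^*(\mathcal{M})\to B(\mathcal{H}_\pi)$ has the approximate unique extension property with respect to $\mathcal{M}$ if, whenever $\psi:C^*(\mathcal{M})\to B(\mathcal{H}_\pi)$ is unital completely positive with $\psi|_{\mathcal{M}}=\pi|_{\mathcal{M}}$, there is a net of unitaries $u_\beta\in B(\mathcal{H}_\pi)$ with $u_\beta^*\psi(t)u_\beta\to\pi(t)$ in the weak operator topology for every $t\in C^*(\mathcal{M})$. *)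

(* Defs.v *)
From HB Require Import structures.
From mathcomp Require Import all_boot all_order all_algebra.
From mathcomp Require Import finmap.
From mathcomp Require Import boolp classical_sets reals topology normedtype.
From mathcomp Require Import sequences.
From mathcomp Require Import complex ring lra.
From mathcomp.analysis.showcase Require Import summability.
Set Implicit Arguments.
Unset Strict Implicit.
Unset Printing Implicit Defensive.
Import Order.TTheory GRing.Theory Num.Theory.
Import numFieldNormedType.Exports.
Local Open Scope classical_set_scope.
Local Open Scope ring_scope.

Section PositiveForm.
Variables (C : numClosedFieldType) (U : lmodType C) (b : U -> U -> C).
Hypothesis bPl : forall y a u v, b (a *: u + v) y = a * b u y + b v y.
Hypothesis bC : forall x y, b y x = (b x y)^*.
Hypothesis b_ge0 : forall x, 0 <= b x x.
Hypothesis b_eq0 : forall x, b x x = 0 -> x = 0.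

Lemma form_Dl x y z : b (x + y) z = b x z + b y z.
Proof. by rewrite -{1}[x]scale1r bPl mul1r. Qed.
Lemma form_0l z : b 0 z = 0.
Proof. by apply: (@addrI _ (b 0 z)); rewrite -form_Dl !addr0. Qed.
Lemma form_Zl a x z : b (a *: x) z = a * b x z.
Proof. by rewrite -{1}[a *: x]addr0 bPl form_0l addr0. Qed.
Lemma form_Nl x z : b (- x) z = - b x z.
Proof. by rewrite -scaleN1r form_Zl mulN1r. Qed.
Lemma form_Dr x y z : b z (x + y) = b z x + b z y.
Proof. by rewrite !(bC _ z) form_Dl rmorphD. Qed.
Lemma form_Zr a x z : b z (a *: x) = a^* * b z x.
Proof. by rewrite !(bC _ z) form_Zl rmorphM. Qed.
Lemma form_Nr x z : b z (- x) = - b z x.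
Proof. by rewrite !(bC _ z) form_Nl rmorphN. Qed.

Lemma form_CauchySchwarz x y : `|b x y| <= sqrtC (b x x) * sqrtC (b y y).
Proof.
have [b0|bn0] := eqVneq (b y y) 0.
  by rewrite (b_eq0 b0) (bC 0) !form_0l conjC0 normr0 sqrtC0 mulr0.
have bgt0 : 0 < b y y by rewrite lt_def bn0 b_ge0.
have bJ : (b y y)^* = b y y by rewrite -bC.
have := b_ge0 (x - (b x y / b y y) *: y).
have -> : b (x - (b x y / b y y) *: y) (x - (b x y / b y y) *: y)
    = b x x - `|b x y| ^+ 2 / b y y.
  rewrite form_Dl !form_Dr !form_Nr !form_Nl !form_Zl !form_Zr normCK.
  rewrite [b y x]bC fmorph_div /= bJ; field.
  exact: bn0.
rewrite subr_ge0 ler_pdivrMr // => le_sq.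
by rewrite -sqrtCM ?nnegrE // -(sqrCK (normr_ge0 _)) ler_sqrtC // nnegrE ?mulr_ge0 // exprn_ge0.
Qed.

Lemma form_triangle x y :
  sqrtC (b (x + y) (x + y)) <= sqrtC (b x x) + sqrtC (b y y).
Proof.
have sge0 z : 0 <= sqrtC (b z z) by rewrite sqrtC_ge0.
rewrite -ler_sqr ?nnegrE ?addr_ge0 // sqrrD !sqrtCK form_Dl !form_Dr [b y x]bC.
rewrite [X in X <= _](_ : _ = b x x + (b x y + (b x y)^*) + b y y); last by ring.
rewrite lerD2r lerD2l.
have -> : b x y + (b x y)^* = 'Re (b x y) *+ 2.
  by rewrite ReE -mulr_natr divfK // pnatr_eq0.
rewrite lerMn2r /=; apply: le_trans (form_CauchySchwarz x y).
exact: (leif_Re_Creal _).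
Qed.

End PositiveForm.

Lemma cvg_ge0 (R : realType) T (F : set_system T) (FF : ProperFilter F)
    (f : T -> R[i]^o) (l : R[i]) :
  f @ F --> (l : R[i]^o) -> (\forall x \near F, 0 <= f x) -> 0 <= l.
Proof.
move=> fl f0; suff <- : `|l| = l by exact: normr_ge0.
have ff : (fun x => `|f x| : R[i]^o) @ F --> (l : R[i]^o).
  apply: cvg_trans fl; apply: near_eq_cvg.
  by near=> x; rewrite ger0_norm //; near: x.
exact: (cvg_unique _ (cvg_norm fl) ff).
Unshelve. all: by end_near. Qed.

Lemma cvg_conjC (R : realType) T (F : set_system T) (FF : Filter F)
    (f : T -> R[i]^o) (l : R[i]) :
  f @ F --> (l : R[i]^o) -> (fun x => (f x)^* : R[i]^o) @ F --> (l^* : R[i]^o).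
Proof.
move=> /cvgrPdist_lt fl; apply/cvgrPdist_lt => e e0.
near=> x; rewrite -rmorphB /= norm_conjC; near: x; exact: fl.
Unshelve. all: by end_near. Qed.

#[global] Existing Instance totally_filter.

Section Sums.
Variables (R : realType) (I : choiceType).
Local Notation C := (R[i]^o).
Implicit Types (A B : {fset I}).

Lemma partial_sumE (V : zmodType) (x : I -> V) A :
  partial_sum x A = \sum_(i <- A) x i.
Proof. by rewrite /partial_sum big_seq_fsetE. Qed.

Lemma partial_sum_le (p : I -> C) A B : (forall i, 0 <= p i) ->
  (A `<=` B)%fset -> partial_sum p A <= partial_sum p B.
Proof.
move=> p0 AB; rewrite !partial_sumE.
rewrite [leRHS](big_fsetID _ (mem A)) /=.
have -> : [fset x in B | x \in A]%fset = A.
  apply/fsetP => i; rewrite !inE /= andbC; case: (boolP (i \in A)) => //= iA.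
  by rewrite (fsubsetP AB).
by rewrite lerDl sumr_ge0.
Qed.

Lemma cvg_partial_sum (p : I -> C) (M : R[i]) : (forall i, 0 <= p i) ->
  (forall A, partial_sum p A <= M) -> cvg (partial_sum p @ totally).
Proof.
move=> p0 pM; pose S := [set complex.Re (partial_sum p A) | A in setT].
have pr A : (complex.Re (partial_sum p A))%:C%C = partial_sum p A.
  by rewrite RRe_real // ger0_real // partial_sumE sumr_ge0.
have Mr : (complex.Re M)%:C%C = M.
  rewrite RRe_real // ger0_real // (le_trans _ (pM fset0)) //.
  by rewrite partial_sumE big_seq_fset0.
have supS : has_sup S.
  split; first by exists (complex.Re (partial_sum p fset0)), fset0.
  exists (complex.Re M) => _ [A _ <-].
  by have := pM A; rewrite -pr -{1}Mr lecR.
apply/cvg_ex; exists ((sup S)%:C%C : C); apply/cvgrPdist_lt => e e0.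
have er : (complex.Re e)%:C%C = e by rewrite RRe_real // gtr0_real.
have re0 : 0 < complex.Re e by rewrite -ltcR er.
have [_ [A _ <-] ltA] := sup_adherent re0 supS.
exists A => // B /= AB; rewrite -pr -rmorphB /=.
have leB : complex.Re (partial_sum p B) <= sup S.
  by apply: sup_ubound; [case: supS|exists B].
rewrite ger0_norm ?lecR ?subr_ge0 // -er ltcR ltrBlDr -ltrBlDl.
apply: lt_le_trans ltA _; rewrite -lecR !pr; exact: partial_sum_le.
Qed.

Lemma sumP (p : I -> C) : cvg (partial_sum p @ totally) ->
  partial_sum p @ totally --> (summability.sum p : C).
Proof. by []. Qed.

Lemma partial_sum_le_sum (p : I -> C) A : (forall i, 0 <= p i) ->
  cvg (partial_sum p @ totally) -> partial_sum p A <= summability.sum p.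
Proof.
move=> p0 /sumP cp; rewrite -subr_ge0.
apply: (@cvg_ge0 _ _ totally _ (fun B => partial_sum p B - partial_sum p A) _).
  exact: (cvgB cp (cvg_cst _)).
by exists A => // B AB /=; rewrite subr_ge0 partial_sum_le.
Qed.

Lemma sum_le (p : I -> C) (M : R[i]) :
  (forall A, partial_sum p A <= M) -> cvg (partial_sum p @ totally) ->
  summability.sum p <= M.
Proof.
move=> pM /sumP cp; rewrite -subr_ge0.
apply: (@cvg_ge0 _ _ totally _ (fun B => M - partial_sum p B) _).
  exact: (cvgB (cvg_cst _) cp).
by exists fset0 => // B _ /=; rewrite subr_ge0.
Qed.

End Sums.

(* A complex Hilbert space: the inner product is linear in its first argument
   and induces the norm of the underlying Banach space. *)
HB.mixin Record isHilbert (R : realType) H & CompleteNormedModule R[i] H := {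
  inner : H -> H -> R[i];
  innerPl : forall y a u v, inner (a *: u + v) y = a * inner u y + inner v y;
  innerC : forall x y, inner y x = (inner x y)^*;
  inner_norm : forall x, inner x x = `|x| ^+ 2
}.

#[short(type="hilbertType")]
HB.structure Definition Hilbert (R : realType) :=
  {H of CompleteNormedModule R[i] H & isHilbert R H}.

Section HilbertTheory.
Variables (R : realType) (H : hilbertType R).
Implicit Types x y z : H.

Lemma inner_ge0 x : 0 <= inner x x.
Proof. by rewrite inner_norm exprn_ge0. Qed.
Lemma inner_eq0 x : inner x x = 0 -> x = 0.
Proof. by rewrite inner_norm => /eqP; rewrite expf_eq0 /= normr_eq0 => /eqP. Qed.

Definition innerDl := form_Dl (@innerPl R H).
Definition inner0l := form_0l (@innerPl R H).
Definition innerZl := form_Zl (@innerPl R H).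
Definition innerNl := form_Nl (@innerPl R H).
Definition innerDr := form_Dr (@innerPl R H) (@innerC R H).
Definition innerZr := form_Zr (@innerPl R H) (@innerC R H).
Definition innerNr := form_Nr (@innerPl R H) (@innerC R H).

Lemma inner_CauchySchwarz x y : `|inner x y| <= `|x| * `|y|.
Proof.
have := form_CauchySchwarz (@innerPl R H) (@innerC R H) inner_ge0 inner_eq0 x y.
by rewrite !inner_norm !sqrCK.
Qed.

Lemma inner_polarization x y :
  inner x y = 4^-1 * (`|x + y| ^+ 2 - `|x - y| ^+ 2
    + 'i * `|x + 'i *: y| ^+ 2 - 'i * `|x - 'i *: y| ^+ 2).
Proof.
rewrite -!inner_norm !(innerDl, innerDr, innerNl, innerNr, innerZl, innerZr).
rewrite conjCi; apply: (@mulfI _ 4); rewrite ?pnatr_eq0 // mulrA divff ?pnatr_eq0 //.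
have := @sqrCi R[i]; set j := 'i => j2.
rewrite mul1r; ring: j2.
Qed.

Lemma normD_sqr_le x y : `|x + y| ^+ 2 <= 2 * `|x| ^+ 2 + 2 * `|y| ^+ 2.
Proof.
apply: (@le_trans _ _ ((`|x| + `|y|) ^+ 2)).
  by rewrite ler_sqr ?nnegrE ?addr_ge0 // ler_normD.
rewrite -subr_ge0 [X in 0 <= X](_ : _ = (`|x| - `|y|) ^+ 2); last by ring.
by rewrite real_exprn_even_ge0 // realB // ger0_real.
Qed.

End HilbertTheory.

Section HilbertSum.
Variables (R : realType) (I : choiceType) (H : I -> hilbertType R).

(* The sum of the `|f i| ^+ 2 is finite: its finite partial sums are bounded. *)
Definition square_summable (f : forall i, H i) : Prop :=
  exists M : R[i], forall A : {fset I}, \sum_(i <- A) `|f i| ^+ 2 <= M.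

Record hilbert_sum : Type := HilbertSum {
  hsum_fun :> forall i, H i;
  hsum_summable : square_summable hsum_fun }.

Lemma hsumP (f g : hilbert_sum) : (forall i, f i = g i) -> f = g.
Proof.
case: f g => [f hf] [g hg] /= fg.
have {}fg : f = g by exact: functional_extensionality_dep.
by subst g; congr HilbertSum; exact: Prop_irrelevance.
Qed.

HB.instance Definition _ := gen_eqMixin hilbert_sum.
HB.instance Definition _ := gen_choiceMixin hilbert_sum.

Lemma square_summable0 : square_summable (fun i => 0).
Proof. by exists 0 => A; rewrite big1 // => i _; rewrite normr0 expr0n. Qed.

Lemma square_summableZ a f : square_summable f -> square_summable (fun i => a *: f i).
Proof.
move=> [M fM]; exists (`|a| ^+ 2 * M) => A.
under eq_bigr do rewrite normrZ exprMn.
by rewrite -mulr_sumr ler_wpM2l ?exprn_ge0.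
Qed.

Lemma square_summableD f g : square_summable f -> square_summable g ->
  square_summable (fun i => f i + g i).
Proof.
move=> [M fM] [N gN]; exists (2 * M + 2 * N) => A.
apply: (@le_trans _ _ (2 * \sum_(i <- A) `|f i| ^+ 2 + 2 * \sum_(i <- A) `|g i| ^+ 2)).
  by rewrite !mulr_sumr -big_split ler_sum // => i _; exact: normD_sqr_le.
by rewrite lerD // ler_wpM2l.
Qed.

Lemma square_summableN f : square_summable f -> square_summable (fun i => - f i).
Proof. by move=> [M fM]; exists M => A; under eq_bigr do rewrite normrN. Qed.

Definition hsum_zero := HilbertSum square_summable0.
Definition hsum_opp (f : hilbert_sum) :=
  HilbertSum (square_summableN (hsum_summable f)).
Definition hsum_add (f g : hilbert_sum) :=
  HilbertSum (square_summableD (hsum_summable f) (hsum_summable g)).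
Definition hsum_scale (a : R[i]) (f : hilbert_sum) :=
  HilbertSum (square_summableZ a (hsum_summable f)).

Lemma hsum_addA : associative hsum_add.
Proof. by move=> f g h; apply: hsumP => i /=; rewrite addrA. Qed.
Lemma hsum_addC : commutative hsum_add.
Proof. by move=> f g; apply: hsumP => i /=; rewrite addrC. Qed.
Lemma hsum_add0 : left_id hsum_zero hsum_add.
Proof. by move=> f; apply: hsumP => i /=; rewrite add0r. Qed.
Lemma hsum_addN : left_inverse hsum_zero hsum_opp hsum_add.
Proof. by move=> f; apply: hsumP => i /=; rewrite addNr. Qed.

HB.instance Definition _ :=
  GRing.isZmodule.Build hilbert_sum hsum_addA hsum_addC hsum_add0 hsum_addN.

Lemma hsum_scaleA a b f : hsum_scale a (hsum_scale b f) = hsum_scale (a * b) f.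
Proof. by apply: hsumP => i /=; rewrite scalerA. Qed.
Lemma hsum_scale1 : left_id 1 hsum_scale.
Proof. by move=> f; apply: hsumP => i /=; rewrite scale1r. Qed.
Lemma hsum_scaleDr : right_distributive hsum_scale +%R.
Proof. by move=> a f g; apply: hsumP => i /=; rewrite scalerDr. Qed.
Lemma hsum_scaleDl f : {morph hsum_scale^~ f : a b / a + b}.
Proof. by move=> a b; apply: hsumP => i /=; rewrite scalerDl. Qed.

HB.instance Definition _ := GRing.Zmodule_isLmodule.Build R[i] hilbert_sum
  hsum_scaleA hsum_scale1 hsum_scaleDr hsum_scaleDl.

Implicit Types f g h : hilbert_sum.

Lemma hsumDE f g i : (f + g) i = f i + g i. Proof. by []. Qed.
Lemma hsumNE f i : (- f) i = - f i. Proof. by []. Qed.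
Lemma hsumZE a f i : (a *: f) i = a *: f i. Proof. by []. Qed.

(* summability.sum is the limit along the net of finite subsets of I; it exists
   here by cvg_hsum_inner. *)
Definition hsum_inner f g : R[i] :=
  summability.sum (fun i => inner (f i) (g i) : R[i]^o).

Lemma cvg_hsum_sqr f :
  cvg (partial_sum (fun i => `|f i| ^+ 2 : R[i]^o) @ totally).
Proof.
have [M fM] := hsum_summable f; apply: (@cvg_partial_sum _ _ _ M) => [i|A].
  exact: exprn_ge0.
by rewrite partial_sumE.
Qed.

Lemma cvg_hsum_inner f g :
  partial_sum (fun i => inner (f i) (g i) : R[i]^o) @ totally
    --> (hsum_inner f g : R[i]^o).
Proof.
apply: sumP.
pose q h A : R[i]^o := partial_sum (fun i => `|h i| ^+ 2 : R[i]^o) A.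
have -> : partial_sum (fun i => inner (f i) (g i) : R[i]^o) =
    (fun A => 4^-1 *: (q (f + g) A - q (f - g) A
    + 'i *: q (f + 'i *: g) A - 'i *: q (f - 'i *: g) A)).
  apply/funext => A; rewrite /q !partial_sumE.
  rewrite !scaler_sumr -!sumrB -big_split -sumrB scaler_sumr.
  by apply: eq_bigr => i _ /=; exact: inner_polarization.
have qc h : cvg (q h @ totally) by exact: cvg_hsum_sqr.
apply: is_cvgZr.
apply: is_cvgB; last exact: is_cvgZr.
apply: is_cvgD; last exact: is_cvgZr.
exact: is_cvgB.
Qed.

Lemma hsum_innerPl h a f g :
  hsum_inner (a *: f + g) h = a * hsum_inner f h + hsum_inner g h.
Proof.
refine (@cvg_unique R[i]^o (@norm_hausdorff _ R[i]^o) _ _ _ _ (@cvg_hsum_inner _ _) _).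
have -> : partial_sum (fun i => inner ((a *: f + g) i) (h i) : R[i]^o) =
    (fun A => a *: partial_sum (fun i => inner (f i) (h i) : R[i]^o) A
      + partial_sum (fun i => inner (g i) (h i) : R[i]^o) A).
  apply/funext => A; rewrite !partial_sumE scaler_sumr -big_split /=.
  by apply: eq_bigr => i _; rewrite innerPl.
exact: (cvgD (cvgZr (@cvg_hsum_inner f h)) (@cvg_hsum_inner g h)).
Qed.

Lemma hsum_innerC f g : hsum_inner g f = (hsum_inner f g)^*.
Proof.
refine (@cvg_unique R[i]^o (@norm_hausdorff _ R[i]^o) _ _ _ _ (@cvg_hsum_inner _ _) _).
have -> : partial_sum (fun i => inner (g i) (f i) : R[i]^o) =
    (fun A => (partial_sum (fun i => inner (f i) (g i) : R[i]^o) A)^* : R[i]^o).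
  apply/funext => A; rewrite !partial_sumE rmorph_sum /=.
  by apply: eq_bigr => i _; rewrite innerC.
exact: (cvg_conjC _ (@cvg_hsum_inner f g)).
Qed.

Lemma hsum_inner_sqr f :
  hsum_inner f f = summability.sum (fun i => `|f i| ^+ 2 : R[i]^o).
Proof.
rewrite /hsum_inner; congr (summability.sum (_ : I -> R[i]^o)).
by apply/funext => i; exact: inner_norm.
Qed.

Lemma hsum_inner_ge f (A : {fset I}) :
  \sum_(i <- A) `|f i| ^+ 2 <= hsum_inner f f.
Proof.
rewrite hsum_inner_sqr.
have := @partial_sum_le_sum R I (fun i => `|f i| ^+ 2) A.
rewrite partial_sumE; apply; last exact: cvg_hsum_sqr.
by move=> i; exact: exprn_ge0.
Qed.

Lemma hsum_inner_le f (M : R[i]) :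
  (forall A : {fset I}, \sum_(i <- A) `|f i| ^+ 2 <= M) -> hsum_inner f f <= M.
Proof.
move=> fM; rewrite hsum_inner_sqr; apply: sum_le; last exact: cvg_hsum_sqr.
by move=> A; rewrite partial_sumE.
Qed.

Lemma hsum_inner_ge0 f : 0 <= hsum_inner f f.
Proof. by have := hsum_inner_ge f fset0; rewrite big_seq_fset0. Qed.

Lemma hsum_inner_coord f i : `|f i| ^+ 2 <= hsum_inner f f.
Proof. by have := hsum_inner_ge f [fset i]%fset; rewrite big_seq_fset1. Qed.

Lemma hsum_inner_eq0 f : hsum_inner f f = 0 -> f = 0.
Proof.
move=> f0; apply: hsumP => i; apply/eqP.
have := hsum_inner_coord f i; rewrite f0 => le0.
have : `|f i| ^+ 2 == 0 by rewrite eq_le le0 exprn_ge0.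
by rewrite expf_eq0 normr_eq0.
Qed.

Definition hsum_norm f : R[i] := sqrtC (hsum_inner f f).

Lemma hsum_normD f g : hsum_norm (f + g) <= hsum_norm f + hsum_norm g.
Proof. exact: (form_triangle hsum_innerPl hsum_innerC hsum_inner_ge0 hsum_inner_eq0). Qed.

Lemma hsum_normZ a f : hsum_norm (a *: f) = `|a| * hsum_norm f.
Proof.
rewrite /hsum_norm (form_Zl hsum_innerPl) (form_Zr hsum_innerPl hsum_innerC).
by rewrite mulrA -normCK sqrtCM ?nnegrE ?exprn_ge0 ?hsum_inner_ge0 // sqrCK.
Qed.

Lemma hsum_norm_eq0 f : hsum_norm f = 0 -> f = 0.
Proof. by move/eqP; rewrite sqrtC_eq0 => /eqP/hsum_inner_eq0. Qed.

HB.instance Definition _ := Lmodule_isNormed.Build R[i] hilbert_sum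
  hsum_normD hsum_normZ hsum_norm_eq0.

Lemma hsum_norm_sqr f : hsum_inner f f = `|f| ^+ 2.
Proof. by rewrite -[RHS]/(hsum_norm f ^+ 2) sqrtCK. Qed.

Lemma hsum_norm_coord f i : `|f i| <= `|f|.
Proof. by rewrite -ler_sqr ?nnegrE // -hsum_norm_sqr hsum_inner_coord. Qed.

Lemma hsum_complete (F : set_system hilbert_sum) :
  ProperFilter F -> cauchy F -> cvg F.
Proof.
move=> FF Fc.
have Fe (e : R[i]) : 0 < e -> exists f : hilbert_sum, \forall g \near F, `|f - g| < e.
  move=> e0; have [f Ff] := (cauchyP F).1 Fc e e0.
  by exists f; move: Ff; rewrite -ball_normE.
have coordc i : cvg ((fun f : hilbert_sum => f i) @ F).
  apply: cauchy_cvg; apply: cauchy_exP => e e0.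
  have [f Ff] := Fe e e0; exists (f i).
  rewrite /nbhs /= /fmap; near=> g; rewrite -ball_normE /ball_ /=.
  apply: le_lt_trans (hsum_norm_coord (f - g) i) _; near: g; exact: Ff.
pose l i : H i := lim ((fun f : hilbert_sum => f i) @ F).
have lc i : (fun f : hilbert_sum => f i) @ F --> l i by exact: coordc.
have bound (f : hilbert_sum) e : 0 < e -> (\forall g \near F, `|f - g| < e) ->
    forall A : {fset I}, \sum_(i <- A) `|f i - l i| ^+ 2 <= e ^+ 2.
  move=> e0 Ff A; rewrite -subr_ge0.
  apply: (@cvg_ge0 _ _ F _
    (fun g => e ^+ 2 - \sum_(i <- A) `|f i - g i| ^+ 2) _).
    apply: cvgB; first exact: cvg_cst.
    apply: cvg_big => [|i _]; first exact: add_continuous.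
    apply: cvgM; apply: cvg_norm;
      exact: (cvgB (cvg_cst _) (lc i)).
  near=> g; rewrite subr_ge0.
  apply: (le_trans (hsum_inner_ge (f - g) A)); rewrite hsum_norm_sqr.
  rewrite ler_sqr ?nnegrE // ?(ltW e0) //.
  by apply: ltW; near: g; exact: Ff.
have [f0 Ff0] := Fe 1 ltr01.
have dsq (f : hilbert_sum) e : 0 < e -> (\forall g \near F, `|f - g| < e) ->
    square_summable (fun i => f i - l i).
  by move=> e0 Ff; exists (e ^+ 2); exact: bound.
have lsq : square_summable l.
  have := square_summableD (hsum_summable f0) (square_summableN (dsq _ _ ltr01 Ff0)).
  by congr square_summable; apply/functional_extensionality_dep => i; rewrite opprB addrC subrK.
apply/cvg_ex; exists (HilbertSum lsq); apply/cvgrPdist_lt => e e0.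
have e20 : 0 < e / 2 by rewrite divr_gt0.
have [f Ff] := Fe _ e20.
near=> g.
rewrite (le_lt_trans (ler_distD f _ _)) // [ltRHS]splitr.
apply: ler_ltD; last by near: g; exact: Ff.
rewrite distrC -ler_sqr ?nnegrE ?(ltW e20) // -hsum_norm_sqr.
by apply: hsum_inner_le; exact: bound.
Unshelve. all: by end_near. Qed.

HB.instance Definition _ := Uniform_isComplete.Build hilbert_sum hsum_complete.

HB.instance Definition _ := isHilbert.Build R hilbert_sum
  hsum_innerPl hsum_innerC hsum_norm_sqr.

End HilbertSum.

Lemma riesz (R : realType) (H : hilbertType R) (phi : H -> R[i]) (M : R[i]) :
  (forall a x y, phi (a *: x + y) = a * phi x + phi y) ->
  (forall x, `|phi x| <= M * `|x|) -> exists z, forall x, phi x = inner x z.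
Proof.
move=> phiP phiM.
have phiD x y : phi (x + y) = phi x + phi y.
  by rewrite -{1}[x]scale1r phiP mul1r.
have phi0 : phi 0 = 0 by apply: (@addrI _ (phi 0)); rewrite -phiD !addr0.
have phiZ a x : phi (a *: x) = a * phi x.
  by rewrite -[a *: x]addr0 phiP phi0 addr0.
have phiB x y : phi (x - y) = phi x - phi y.
  by rewrite phiD -scaleN1r phiZ mulN1r.
have phim x : `|phi x| <= `|M| * `|x|.
  rewrite -[X in _ * X]normr_id -normrM (le_trans (phiM x)) // real_ler_norm //.
  exact: ger0_real (le_trans (normr_ge0 _) (phiM x)).
pose m : R[i] := `|M|; have m0 : 0 <= m by exact: normr_ge0.
pose J x : R[i] := `|x| ^+ 2 - (phi x + (phi x)^*).
have Jreal x : J x \is Num.real.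
  rewrite realB ?realX ?normr_real //; apply/CrealP.
  by rewrite rmorphD /= conjCK addrC.
have JE x : (complex.Re (J x))%:C%C = J x by rewrite RRe_real.
have Jge x : - m ^+ 2 <= J x.
  have : phi x + (phi x)^* <= 2 * (m * `|x|).
    have -> : phi x + (phi x)^* = 'Re (phi x) *+ 2.
      by rewrite ReE -mulr_natr divfK // pnatr_eq0.
    rewrite mulr_natl lerMn2r /=; apply: le_trans (phim x).
    exact: leif_Re_Creal.
  rewrite -subr_ge0 => le1; rewrite -subr_ge0.
  have -> : J x - - m ^+ 2 = (`|x| - m) ^+ 2
      + (2 * (m * `|x|) - (phi x + (phi x)^*)) by rewrite /J; ring.
  by rewrite addr_ge0 // real_exprn_even_ge0 // realB // ger0_real.
have Jpar x y : `|2^-1 *: (x - y)| ^+ 2 =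
    2^-1 * (J x + J y) - J (2^-1 *: (x + y)).
  have half : (2^-1 : R[i])^* = 2^-1 by rewrite geC0_conj // invr_ge0 ler0n.
  rewrite /J phiZ phiD -!inner_norm.
  rewrite !(innerZl, innerZr, innerDl, innerDr, innerNl, innerNr).
  by rewrite rmorphM rmorphD /= half; field.
pose S := [set complex.Re (J x) | x in setT].
have Slb : lbound S (complex.Re (- m ^+ 2)).
  apply/lbP => _ [x _ <-]; rewrite -lecR JE RRe_real ?Jge //.
  by rewrite realN realX // ger0_real.
have infS : has_inf S.
  by split; [exists (complex.Re (J 0)), 0|exists (complex.Re (- m ^+ 2))].
pose d : R[i] := (inf S)%:C%C.
have dJ x : d <= J x by rewrite -JE lecR; apply: ge_inf; [case: infS|exists x].
pose F := filter_from [set e : R[i] | 0 < e] (fun e => [set x : H | J x < d + e]).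
have Fex e : 0 < e -> exists x, J x < d + e.
  move=> e0; have er : (complex.Re e)%:C%C = e by rewrite RRe_real // gtr0_real.
  have re0 : 0 < complex.Re e by rewrite -ltcR er.
  have [_ [x _ <-] xlt] := inf_adherent re0 infS; exists x.
  by rewrite -JE -er -rmorphD /= ltcR.
have FF : ProperFilter F.
  apply: filter_from_proper; last by move=> e /Fex [x]; exists x.
  apply: filter_from_filter; first by exists 1; exact: ltr01.
  move=> e f e0 f0; have /orP[ef|fe] := real_leVge (gtr0_real e0) (gtr0_real f0).
    by exists e => // x /= xe; split=> //; apply: lt_le_trans xe _; rewrite lerD2l.
  by exists f => // x /= xf; split=> //; apply: lt_le_trans xf _; rewrite lerD2l.
have Fc : cauchy F.
  apply: cauchy_exP => e e0; pose e1 := (e / 4) ^+ 2.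
  have e40 : 0 < e / 4 by rewrite divr_gt0.
  have e10 : 0 < e1 by rewrite exprn_gt0.
  have [x xe] := Fex _ e10; exists x; exists e1 => // y /= ye.
  rewrite -ball_normE /ball_ /=.
  have : `|2^-1 *: (x - y)| ^+ 2 < (e / 4) ^+ 2.
    rewrite Jpar ltrBlDl.
    apply: (@lt_le_trans _ _ (2^-1 * ((d + e1) + (d + e1)))).
      by rewrite ltr_pM2l ?invr_gt0 // ltrD.
    rewrite [leLHS](_ : _ = d + e1); last by field.
    by rewrite lerD2r.
  rewrite ltr_sqr ?nnegrE ?(ltW e40) // normrZ ger0_norm ?invr_ge0 // => lt1.
  have : 2 * (2^-1 * `|x - y|) < 2 * (e / 4) by rewrite ltr_pM2l.
  rewrite mulrA divff ?pnatr_eq0 // mul1r => /lt_trans; apply.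
  rewrite -subr_gt0 [X in 0 < X](_ : _ = e / 2); last by field.
  by rewrite divr_gt0.
have [z Fz] : exists z : H, F --> z by apply/cvg_ex; exact: cauchy_cvg.
have phic : (phi x : R[i]^o) @[x --> F] --> (phi z : R[i]^o).
  apply/cvgrPdist_lt => e e0; have m10 : 0 < m + 1 by rewrite ltr_wpDl.
  have em0 : 0 < e / (m + 1) by rewrite divr_gt0.
  have Fe := (@cvgrPdist_lt _ _ _ F _ id z).1 Fz _ em0.
  near=> x; rewrite -phiB (le_lt_trans (phim _)) //.
  apply: (@le_lt_trans _ _ ((m + 1) * `|z - x|)); first by rewrite ler_wpM2r ?lerDl.
  by rewrite mulrC -ltr_pdivlMr //; near: x.
have Jc : (J x : R[i]^o) @[x --> F] --> (J z : R[i]^o).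
  apply: cvgB; first by apply: cvgM; exact: cvg_norm.
  exact: (cvgD phic (cvg_conjC _ phic)).
have Jz x : J z <= J x.
  apply: le_trans (dJ x); apply/ler_addgt0Pl => e e0.
  rewrite addrC -subr_ge0; apply: (@cvg_ge0 _ _ F _ (fun x => d + e - J x) _).
    exact: (cvgB (cvg_cst _) Jc).
  by exists e => // y /= ye; rewrite subr_ge0 ltW.
exists z => h; apply/eqP; rewrite -subr_eq0; apply/negPn/negP => c0.
pose c := phi h - inner h z.
pose t : R[i] := (`|h| ^+ 2 + 1)^-1.
have h10 : 0 < `|h| ^+ 2 + 1 by rewrite ltr_wpDl ?exprn_ge0.
have t0 : 0 < t by rewrite invr_gt0.
have := Jz (z + (t * c^*) *: h).
have tr : t^* = t by rewrite geC0_conj // ltW.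
rewrite -subr_ge0.
have -> : J (z + (t * c^*) *: h) - J z
    = t * `|c| ^+ 2 * (t * `|h| ^+ 2 - 2).
  rewrite /J phiD phiZ -!inner_norm !(innerZl, innerZr, innerDl, innerDr).
  rewrite [inner z h]innerC normCK /c !(rmorphM, rmorphB, rmorphD) /=.
  rewrite !conjCK tr; ring.
rewrite pmulr_rge0 ?mulr_gt0 ?exprn_gt0 ?normr_gt0 // subr_ge0 => le2.
have : t * `|h| ^+ 2 < 1 by rewrite mulrC ltr_pdivrMr // mul1r ltrDl.
by move=> /(le_lt_trans le2); rewrite ltrn1.
Unshelve. all: by end_near. Qed.

Section BoundedOperators.
Variables (R : realType) (H : hilbertType R).

Definition bounded_map (T : H -> H) : Prop :=
  exists M : R[i], forall x, `|T x| <= M * `|x|.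

(* B(H); below, * is composition and 1 the identity. *)
Record bounded_op : Type := BoundedOp {
  op_fun :> H -> H;
  op_linear : linear op_fun;
  op_bounded : bounded_map op_fun }.

Lemma opP (S T : bounded_op) : (forall x, S x = T x) -> S = T.
Proof.
case: S T => [S lS bS] [T lT bT] /= ST.
have {}ST : S = T by exact: funext.
by subst T; congr BoundedOp; exact: Prop_irrelevance.
Qed.

HB.instance Definition _ (T : bounded_op) :=
  GRing.isLinear.Build R[i] H H _ (op_fun T) (op_linear T).

HB.instance Definition _ := gen_eqMixin bounded_op.
HB.instance Definition _ := gen_choiceMixin bounded_op.

Lemma op_pos_bound (T : bounded_op) :
  exists2 M : R[i], 0 <= M & forall x, `|T x| <= M * `|x|.
Proof.
have [M TM] := op_bounded T; exists `|M| => // x.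
rewrite -[X in _ * X]normr_id -normrM (le_trans (TM x)) // real_ler_norm //.
exact: ger0_real (le_trans (normr_ge0 _) (TM x)).
Qed.

Lemma zero_linear : linear (fun _ : H => 0 : H).
Proof. by move=> a x y; rewrite scaler0 addr0. Qed.
Lemma zero_bounded : bounded_map (fun _ : H => 0).
Proof. by exists 0 => x; rewrite normr0 mul0r. Qed.

Lemma add_linear (S T : bounded_op) : linear (fun x => S x + T x).
Proof. by move=> a x y; rewrite !linearP scalerDr addrACA. Qed.
Lemma add_bounded (S T : bounded_op) : bounded_map (fun x => S x + T x).
Proof.
have [[M SM] [N TN]] := (op_bounded S, op_bounded T).
by exists (M + N) => x; rewrite mulrDl (le_trans (ler_normD _ _)) // lerD.
Qed.

Lemma opp_linear (T : bounded_op) : linear (fun x => - T x).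
Proof. by move=> a x y; rewrite linearP opprD scalerN. Qed.
Lemma opp_bounded (T : bounded_op) : bounded_map (fun x => - T x).
Proof. by have [M TM] := op_bounded T; exists M => x; rewrite normrN. Qed.

Lemma scale_linear a (T : bounded_op) : linear (fun x => a *: T x).
Proof. by move=> b x y; rewrite linearP scalerDr !scalerA mulrC. Qed.
Lemma scale_bounded a (T : bounded_op) : bounded_map (fun x => a *: T x).
Proof.
have [M TM] := op_bounded T; exists (`|a| * M) => x.
by rewrite normrZ -mulrA ler_wpM2l.
Qed.

Lemma id_linear : linear (fun x : H => x). Proof. by []. Qed.
Lemma id_bounded : bounded_map (fun x => x).
Proof. by exists 1 => x; rewrite mul1r. Qed.

Lemma comp_linear (S T : bounded_op) : linear (fun x => S (T x)).
Proof. by move=> a x y; rewrite !linearP. Qed.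
Lemma comp_bounded (S T : bounded_op) : bounded_map (fun x => S (T x)).
Proof.
have [[M M0 SM] [N N0 TN]] := (op_pos_bound S, op_pos_bound T).
by exists (M * N) => x; rewrite (le_trans (SM _)) // -mulrA ler_wpM2l.
Qed.

Definition op_zero := BoundedOp zero_linear zero_bounded.
Definition op_add S T := BoundedOp (add_linear S T) (add_bounded S T).
Definition op_opp T := BoundedOp (opp_linear T) (opp_bounded T).
Definition op_scale a T := BoundedOp (scale_linear a T) (scale_bounded a T).
Definition op_one := BoundedOp id_linear id_bounded.
Definition op_comp S T := BoundedOp (comp_linear S T) (comp_bounded S T).

Lemma op_addA : associative op_add.
Proof. by move=> S T U; apply: opP => x /=; rewrite addrA. Qed.
Lemma op_addC : commutative op_add.
Proof. by move=> S T; apply: opP => x /=; rewrite addrC. Qed.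
Lemma op_add0 : left_id op_zero op_add.
Proof. by move=> S; apply: opP => x /=; rewrite add0r. Qed.
Lemma op_addN : left_inverse op_zero op_opp op_add.
Proof. by move=> S; apply: opP => x /=; rewrite addNr. Qed.

HB.instance Definition _ :=
  GRing.isZmodule.Build bounded_op op_addA op_addC op_add0 op_addN.

Lemma op_scaleA a b T : op_scale a (op_scale b T) = op_scale (a * b) T.
Proof. by apply: opP => x /=; rewrite scalerA. Qed.
Lemma op_scale1 : left_id 1 op_scale.
Proof. by move=> T; apply: opP => x /=; rewrite scale1r. Qed.
Lemma op_scaleDr : right_distributive op_scale +%R.
Proof. by move=> a S T; apply: opP => x /=; rewrite scalerDr. Qed.
Lemma op_scaleDl T : {morph op_scale^~ T : a b / a + b}.
Proof. by move=> a b; apply: opP => x /=; rewrite scalerDl. Qed.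

HB.instance Definition _ := GRing.Zmodule_isLmodule.Build R[i] bounded_op
  op_scaleA op_scale1 op_scaleDr op_scaleDl.

Lemma op_compA : associative op_comp.
Proof. by move=> S T U; apply: opP. Qed.
Lemma op_comp1l : left_id op_one op_comp.
Proof. by move=> S; apply: opP. Qed.
Lemma op_comp1r : right_id op_one op_comp.
Proof. by move=> S; apply: opP. Qed.
Lemma op_compDl : left_distributive op_comp +%R.
Proof. by move=> S T U; apply: opP. Qed.
Lemma op_compDr : right_distributive op_comp +%R.
Proof. by move=> S T U; apply: opP => x /=; rewrite linearD. Qed.

HB.instance Definition _ := GRing.Zmodule_isPzRing.Build bounded_op
  op_compA op_comp1l op_comp1r op_compDl op_compDr.

Lemma adjoint_exists (T : bounded_op) y :
  exists z, forall x, inner (T x) y = inner x z.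
Proof.
have [M TM] := op_bounded T.
apply: (@riesz _ _ (fun x => inner (T x) y) (`|y| * M)).
  by move=> a u v /=; rewrite linearP innerPl.
move=> x; rewrite (le_trans (inner_CauchySchwarz _ _)) // mulrC -mulrA.
by rewrite ler_wpM2l.
Qed.

Definition adjoint_fun (T : bounded_op) (y : H) : H :=
  sval (cid (adjoint_exists T y)).

Lemma adjoint_funP (T : bounded_op) x y : inner (T x) y = inner x (adjoint_fun T y).
Proof. by rewrite /adjoint_fun; case: cid. Qed.

Lemma inner_inj (y z : H) : (forall x, inner x y = inner x z) -> y = z.
Proof.
move=> yz; apply/eqP; rewrite -subr_eq0; apply/eqP/inner_eq0.
by rewrite innerDr innerNr yz subrr.
Qed.

Lemma adjoint_linear T : linear (adjoint_fun T).
Proof.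
move=> a y z; apply: inner_inj => x.
by rewrite innerDr innerZr -!adjoint_funP innerDr innerZr.
Qed.

Lemma adjoint_bounded T : bounded_map (adjoint_fun T).
Proof.
have [M M0 TM] := op_pos_bound T; exists M => y.
have [->|y0] := eqVneq (adjoint_fun T y) 0; first by rewrite normr0 mulr_ge0.
rewrite -(ler_pM2l (_ : 0 < `|adjoint_fun T y|)) ?normr_gt0 //.
rewrite -expr2 -inner_norm -adjoint_funP -[leLHS]ger0_norm.
  rewrite (le_trans (inner_CauchySchwarz _ _)) // mulrCA mulrA.
  by rewrite ler_wpM2r.
by rewrite adjoint_funP inner_ge0.
Qed.

Definition adjoint T := BoundedOp (adjoint_linear T) (adjoint_bounded T).

Lemma adjointP (T : bounded_op) x y : inner (T x) y = inner x (adjoint T y).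
Proof. exact: adjoint_funP. Qed.

Definition unitary (u : bounded_op) : Prop :=
  adjoint u * u = 1 /\ u * adjoint u = 1.

Definition norm_closed (A : set bounded_op) : Prop := forall T,
  (forall e : R[i], 0 < e ->
     exists2 S, A S & forall x, `|(T - S) x| <= e * `|x|) -> A T.

Record linear_subspace (A : set bounded_op) : Prop := LinearSubspace {
  subspace0 : A 0;
  subspaceP : forall a S T, A S -> A T -> A (a *: S + T) }.

(* No unit is required; generated_cstar M contains 1 when M does. *)
Record cstar_subalgebra (A : set bounded_op) : Prop := CstarSubalgebra {
  cstar_subspace : linear_subspace A;
  cstarM : forall S T, A S -> A T -> A (S * T);
  cstar_adjoint : forall T, A T -> A (adjoint T);
  cstar_closed : norm_closed A }.

Record unital_operator_space (M : set bounded_op) : Prop := UnitalOperatorSpace {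
  opspace_subspace : linear_subspace M;
  opspace1 : M 1 }.

Definition generated_cstar (M : set bounded_op) : set bounded_op :=
  smallest cstar_subalgebra M.

(* Positivity of the operator that the matrix a defines on H^n. The order of
   R[i] makes 0 <= z say that z is real and nonnegative. *)
Definition mx_positive n (a : 'M[bounded_op]_n) : Prop :=
  forall x : 'I_n -> H, 0 <= \sum_(i < n) \sum_(j < n) inner (a i j (x j)) (x i).

End BoundedOperators.

(* A map A -> B(K) is given as a function on the whole of B(H); the notions
   below only depend on its restriction to A. *)
Section Maps.
Variables (R : realType) (H K : hilbertType R).
Implicit Types (A : set (bounded_op H)) (f : bounded_op H -> bounded_op K).

Definition linear_on A f : Prop :=
  forall a S T, A S -> A T -> f (a *: S + T) = a *: f S + f T.

Record star_representation A f : Prop := StarRepresentation {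
  rep_linear : linear_on A f;
  rep1 : f 1 = 1;
  repM : forall S T, A S -> A T -> f (S * T) = f S * f T;
  rep_adjoint : forall T, A T -> f (adjoint T) = adjoint (f T) }.

Record unital_completely_positive A f : Prop := UnitalCompletelyPositive {
  ucp_linear : linear_on A f;
  ucp1 : f 1 = 1;
  ucp_positive : forall n (a : 'M[bounded_op H]_n),
    (forall i j, A (a i j)) -> mx_positive a -> mx_positive (map_mx f a) }.

End Maps.

Record directed (B : Type) (le : B -> B -> Prop) : Prop := Directed {
  directed_inhabited : inhabited B;
  directed_refl : forall b, le b b;
  directed_trans : forall a b c, le a b -> le b c -> le a c;
  directed_ub : forall a b, exists c, le a c /\ le b c }.

(* Limits along the filter of tails are limits of nets indexed by (B, le). *)
Definition tails (B : Type) (le : B -> B -> Prop) : set_system B :=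
  filter_from setT (fun b => [set c | le b c]).

Lemma tails_filter B (le : B -> B -> Prop) : directed le -> ProperFilter (tails le).
Proof.
move=> [[b0] lexx letr leub]; apply: filter_from_proper; last first.
  by move=> b _; exists b; exact: lexx.
apply: filter_from_filter; first by exists b0.
move=> a b _ _; have [c [ac bc]] := leub a b.
by exists c => // d cd; split; [exact: letr ac cd|exact: letr bc cd].
Qed.

(* Convergence in the weak operator topology. *)
Definition wot_cvg (R : realType) (K : hilbertType R) B (F : set_system B)
    (T_ : B -> bounded_op K) (T : bounded_op K) : Prop :=
  forall x y, (inner (T_ b x) y : R[i]^o) @[b --> F] --> (inner (T x) y : R[i]^o).

Definition approximate_uep (R : realType) (H K : hilbertType R)
    (M : set (bounded_op H)) (pi : bounded_op H -> bounded_op K) : Prop :=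
  forall psi : bounded_op H -> bounded_op K,
    unital_completely_positive (generated_cstar M) psi ->
    (forall t, M t -> psi t = pi t) ->
    exists (B : Type) (le : B -> B -> Prop) (u : B -> bounded_op K),
      [/\ directed le, (forall b, unitary (u b)) &
          forall t, generated_cstar M t ->
            wot_cvg (tails le) (fun b => adjoint (u b) * psi t * u b) (pi t)].

Section DirectSum.
Variables (R : realType) (I : choiceType) (K : I -> hilbertType R).

Definition uniformly_bounded (T : forall i, bounded_op (K i)) : Prop :=
  exists M : R[i], forall i x, `|T i x| <= M * `|x|.

Lemma uniform_pos_bound T : uniformly_bounded T ->
  exists2 M : R[i], 0 <= M & forall i x, `|T i x| <= M * `|x|.
Proof.
move=> [M TM]; exists `|M| => // i x.
rewrite -[X in _ * X]normr_id -normrM (le_trans (TM i x)) // real_ler_norm //.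
exact: ger0_real (le_trans (normr_ge0 _) (TM i x)).
Qed.

Lemma diag_sqr_le (T : forall i, bounded_op (K i)) (M : R[i]) (f : hilbert_sum K) :
  0 <= M -> (forall i x, `|T i x| <= M * `|x|) ->
  forall A : {fset I}, \sum_(i <- A) `|T i (f i)| ^+ 2 <= (M * `|f|) ^+ 2.
Proof.
move=> M0 TM A; rewrite exprMn -hsum_norm_sqr.
apply: le_trans (ler_wpM2l (exprn_ge0 2 M0) (hsum_inner_ge f A)).
rewrite mulr_sumr ler_sum // => i _; rewrite -exprMn.
by rewrite ler_sqr ?nnegrE ?mulr_ge0.
Qed.

Lemma diag_summable T : uniformly_bounded T -> forall f : hilbert_sum K,
  square_summable (fun i => T i (f i)).
Proof.
move=> /uniform_pos_bound [M M0 TM] f.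
by exists ((M * `|f|) ^+ 2); exact: diag_sqr_le.
Qed.

Definition diag_fun T (Tb : uniformly_bounded T) (f : hilbert_sum K) :
    hilbert_sum K := HilbertSum (diag_summable Tb f).

Lemma diag_linear T (Tb : uniformly_bounded T) : linear (diag_fun Tb).
Proof. by move=> a f g; apply: hsumP => i /=; rewrite linearP. Qed.

Lemma diag_bounded T (Tb : uniformly_bounded T) : bounded_map (diag_fun Tb).
Proof.
have [M M0 TM] := uniform_pos_bound Tb; exists M => f.
rewrite -ler_sqr ?nnegrE ?mulr_ge0 // -[leLHS]hsum_norm_sqr.
by apply: hsum_inner_le; exact: diag_sqr_le.
Qed.

(* The value 0 for a family that is not uniformly bounded is never reached by
   a direct sum of *-representations: see rep_sum_bounded and rep_sumE. *)
Definition op_sum (T : forall i, bounded_op (K i)) : bounded_op (hilbert_sum K) :=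
  if pselect (uniformly_bounded T) is left Tb
  then BoundedOp (diag_linear Tb) (diag_bounded Tb) else 0.

Lemma op_sumE T (f : hilbert_sum K) i :
  uniformly_bounded T -> op_sum T f i = T i (f i).
Proof. by rewrite /op_sum; case: pselect. Qed.

Definition rep_sum (H : hilbertType R)
    (pi : forall i, bounded_op H -> bounded_op (K i)) (t : bounded_op H) :
    bounded_op (hilbert_sum K) := op_sum (fun i => pi i t).

End DirectSum.

Section Contractive.
Variables (R : realType) (H : hilbertType R).
Implicit Types (S T : bounded_op H) (A : set (bounded_op H)).

Lemma op_norm T : exists N : R[i], [/\ 0 <= N, forall x, `|T x| <= N * `|x| &
  forall N' : R[i], 0 <= N' -> (forall x, `|T x| <= N' * `|x|) -> N <= N'].
Proof.
pose B := [set r : R | 0 <= r /\ forall x, `|T x| <= r%:C%C * `|x|].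
have ReK (a : R[i]) : 0 <= a -> (complex.Re a)%:C%C = a.
  by move=> a0; rewrite RRe_real // ger0_real.
have BP (a : R[i]) : 0 <= a -> (forall x, `|T x| <= a * `|x|) -> B (complex.Re a).
  by move=> a0 Ta; split=> [|x]; rewrite -?lecR ReK.
have infB : has_inf B.
  split; last by exists 0 => r [].
  by have [a a0 Ta] := op_pos_bound T; exists (complex.Re a); exact: BP.
exists ((inf B)%:C%C); split=> [|x|N' N0 TN].
- by rewrite ler0c; apply: lb_le_inf => [|r []//]; case: infB.
- have [x0|xn0] := eqVneq `|x| 0.
    have [a _ Ta] := op_pos_bound T.
    by apply: le_trans (Ta x) _; rewrite x0 !mulr0.
  have xgt0 : 0 < `|x| by rewrite lt_def xn0 /=.
  rewrite -ler_pdivrMr // -[leLHS]ReK ?divr_ge0 // lecR.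
  apply: lb_le_inf; first by case: infB.
  by move=> r [r0 /(_ x)]; rewrite -ler_pdivrMr // -[leLHS]ReK ?divr_ge0 // lecR.
- by rewrite -(ReK N') // lecR; apply: ge_inf; [case: infB|exact: BP].
Qed.

Lemma expr_small (q : R[i]) e : 0 <= q -> q < 1 -> 0 < e -> exists n, q ^+ n < e.
Proof.
move=> q0 q1 e0.
have ReK (a : R[i]) : 0 <= a -> (complex.Re a)%:C%C = a.
  by move=> a0; rewrite RRe_real // ger0_real.
have r0 : 0 <= complex.Re q by rewrite -lecR ReK.
have r1 : complex.Re q < 1 by rewrite -ltcR ReK.
have er : 0 < complex.Re e by rewrite -ltcR ReK // ltW.
have qn : `|complex.Re q| < 1 by rewrite ger0_norm.
have [n _ /(_ n (leqnn n)) /=] := (@cvgrPdist_lt _ _ _ _ _ _ _).1 (cvg_expr qn) _ er.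
rewrite sub0r normrN ger0_norm ?exprn_ge0 // => lt_e; exists n.
by rewrite -(ReK q) // -(ReK e) ?ltW // -rmorphXn /= ltcR.
Qed.

Lemma subspace_sum A n (s : 'I_n -> bounded_op H) : linear_subspace A ->
  (forall i, A (s i)) -> A (\sum_(i < n) s i).
Proof.
move=> [A0 AP] As; elim/big_ind: _ => // S T AS AT.
by rewrite -[S]scale1r; exact: AP.
Qed.

Lemma cstarX A S n : cstar_subalgebra A -> A 1 -> A S -> A (S ^+ n).
Proof.
by move=> [_ AM _ _] A1 AS; elim: n => [//|n IH]; rewrite exprS; exact: AM.
Qed.

(* 1 - S is left invertible in A when the norm of S is less than 1. *)
Lemma neumann A S (q : R[i]) : cstar_subalgebra A -> A 1 -> A S ->
  0 <= q -> q < 1 -> (forall x, `|S x| <= q * `|x|) ->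
  exists2 V, A V & V * (1 - S) = 1.
Proof.
move=> cA A1 AS q0 q1 Sq.
have q10 : 0 < 1 - q by rewrite subr_gt0.
pose V n := \sum_(k < n) S ^+ k.
have VS n : V n.+1 = V n + S ^+ n by rewrite /V big_ord_recr.
have AV n : A (V n).
  by apply: subspace_sum => [|i]; [case: cA|exact: cstarX].
have SX n x : `|(S ^+ n) x| <= q ^+ n * `|x|.
  elim: n => [|n IH]; first by rewrite !expr0 mul1r.
  rewrite exprS (le_trans (Sq _)) // exprS -mulrA ler_wpM2l //.
have Vdist n j x : `|V (n + j)%N x - V n x| <= q ^+ n / (1 - q) * `|x|.
  have : `|V (n + j)%N x - V n x| <= (q ^+ n - q ^+ (n + j)) / (1 - q) * `|x|.
    elim: j => [|j IH]; first by rewrite addn0 !subrr normr0 !mul0r.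
    rewrite addnS VS.
    have -> : (V (n + j)%N + S ^+ (n + j)) x - V n x
      = (V (n + j)%N x - V n x) + (S ^+ (n + j)) x by rewrite addrAC.
    apply: le_trans (ler_normD _ _) _; apply: le_trans (lerD IH (SX _ _)) _.
    rewrite -mulrDl ler_wpM2r // exprS.
    rewrite [leLHS](_ : _ = (q ^+ n - q * q ^+ (n + j)) / (1 - q)) //.
    by field; rewrite gt_eqF.
  move=> /le_trans; apply; apply: ler_wpM2r => //; apply: ler_wpM2r.
    by rewrite invr_ge0 ltW.
  by rewrite lerBlDr lerDl exprn_ge0.
have small (e : R[i]) : 0 < e -> exists n, q ^+ n / (1 - q) < e.
  move=> e0; have [n ne] := expr_small q0 q1 (mulr_gt0 e0 q10).
  by exists n; rewrite ltr_pdivrMr.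
have cV x : cvg (V n x @[n --> \oo]).
  apply: cauchy_cvg; apply: cauchy_exP => e e0.
  have x1 : 0 < `|x| + 1 by rewrite ltr_wpDl.
  have [n ne] := small _ (divr_gt0 e0 x1); exists (V n x).
  exists n => // m /= /subnKC <-; rewrite -ball_normE /ball_ /= distrC.
  apply: le_lt_trans (Vdist _ _ _) _.
  apply: (@le_lt_trans _ _ (q ^+ n / (1 - q) * (`|x| + 1))).
    by rewrite ler_wpM2l ?lerDl // divr_ge0 ?exprn_ge0 // ltW.
  by rewrite -ltr_pdivlMr.
pose W x : H := lim (V n x @[n --> \oo]).
have VW x : V n x @[n --> \oo] --> W x by exact: cV.
have Wdist n x : `|W x - V n x| <= q ^+ n / (1 - q) * `|x|.
  rewrite -subr_ge0.
  apply: (@cvg_ge0 _ _ \oo _ (fun m => q ^+ n / (1 - q) * `|x| - `|V m x - V n x|) _).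
    apply: cvgB; first exact: cvg_cst.
    by apply: cvg_norm; exact: (cvgB (VW x) (cvg_cst _)).
  by exists n => // m /= /subnKC <-; rewrite subr_ge0.
have Wlin : linear W.
  move=> a x y; apply: (cvg_unique (@norm_hausdorff _ H) (VW _)).
  rewrite (_ : (fun n => _) = (fun n => a *: V n x + V n y)); last first.
    by apply/funext => n; rewrite linearP.
  exact: (cvgD (cvgZr (VW x)) (VW y)).
have Wbd : bounded_map W.
  exists (q ^+ 0 / (1 - q)) => x; have := Wdist 0%N x.
  by rewrite /V big_ord0 subr0.
exists (BoundedOp Wlin Wbd).
  case: cA => _ _ _; apply => e /small [n ne]; exists (V n) => // x.
  by apply: le_trans (Wdist n x) _; rewrite ler_wpM2r // ltW.
apply: opP => x; apply: (cvg_unique (@norm_hausdorff _ H) (VW _)).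
have VSx n : V n ((1 - S) x) = x - (S ^+ n) x.
  elim: n => [|n IH]; first by rewrite /V big_ord0 expr0 subrr.
  have -> y : V n.+1 y = V n y + (S ^+ n) y by rewrite VS.
  have -> : (S ^+ n) ((1 - S) x) = (S ^+ n) x - (S ^+ n.+1) x.
    by rewrite exprSr -linearB.
  by rewrite IH addrA subrK.
apply/cvgrPdist_lt => e e0.
have x1 : 0 < `|x| + 1 by rewrite ltr_wpDl.
have [n ne] := expr_small q0 q1 (divr_gt0 e0 x1); exists n => // m /= nm.
rewrite VSx opprB addrC subrK.
apply: le_lt_trans (SX _ _) _.
apply: (@le_lt_trans _ _ (q ^+ n * (`|x| + 1))).
  by rewrite ler_pM ?exprn_ge0 ?lerDl // ler_wiXn2l // ltW.
by rewrite -ltr_pdivlMr.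
Qed.

End Contractive.

Lemma adjoint_le (R : realType) (H : hilbertType R) (T : bounded_op H) (M : R[i]) :
  0 <= M -> (forall x, `|T x| <= M * `|x|) ->
  forall y, `|adjoint T y| <= M * `|y|.
Proof.
move=> M0 TM y.
have [->|y0] := eqVneq (adjoint T y) 0; first by rewrite normr0 mulr_ge0.
rewrite -(ler_pM2l (_ : 0 < `|adjoint T y|)) ?normr_gt0 //.
rewrite -expr2 -inner_norm -adjointP -[leLHS]ger0_norm.
  rewrite (le_trans (inner_CauchySchwarz _ _)) // mulrCA mulrA.
  by rewrite ler_wpM2r.
by rewrite adjointP inner_ge0.
Qed.

(* *-representations are contractive; no boundedness is assumed of them. *)
Lemma rep_contractive (R : realType) (H K : hilbertType R)
    (A : set (bounded_op H)) (f : bounded_op H -> bounded_op K) T (m : R[i]) :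
  cstar_subalgebra A -> A 1 -> star_representation A f -> A T ->
  0 <= m -> (forall x, `|T x| <= m * `|x|) -> forall y, `|f T y| <= m * `|y|.
Proof.
move=> cA A1 [fl f1 fM fJ] AT m0 Tm.
have [[_ AP] AM AJ _] := cA.
pose P := adjoint T * T; pose p := f P.
have AJT : A (adjoint T) by exact: AJ.
have APP : A P by exact: AM.
have pE : p = adjoint (f T) * f T by rewrite /p fM // fJ.
have Pm x : `|P x| <= m ^+ 2 * `|x|.
  by rewrite (le_trans (adjoint_le m0 Tm _)) // expr2 -mulrA ler_wpM2l.
have psa x y : inner (p x) y = inner x (p y).
  rewrite pE [LHS]innerC -[inner y _]/(inner y (adjoint (f T) (f T x))) -adjointP.
  by rewrite -innerC adjointP.
have [N [N0 pN Nmin]] := op_norm p.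
have Nm : N <= m ^+ 2.
  rewrite real_leNgt ?realX ?ger0_real //; apply/negP => mN.
  have Ngt0 : 0 < N by apply: le_lt_trans mN; rewrite exprn_ge0.
  have Nn0 : N != 0 by rewrite gt_eqF.
  pose q := (m ^+ 2 / N) ^+ 2.
  pose S := N ^- 2 *: (P * P).
  have AS : A S.
    by rewrite -[S]addr0; apply: AP; [exact: AM|case: (cstar_subspace cA)].
  have q0 : 0 <= q by rewrite exprn_ge0 // divr_ge0 // exprn_ge0.
  have q1 : q < 1.
    by rewrite expr_lt1 ?divr_ge0 ?exprn_ge0 // ltr_pdivrMr // mul1r.
  have Sq x : `|S x| <= q * `|x|.
    rewrite [S x]/(N ^- 2 *: P (P x)) normrZ ger0_norm ?invr_ge0 ?exprn_ge0 //.
    have -> : q * `|x| = N ^- 2 * (m ^+ 2 * (m ^+ 2 * `|x|)).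
      by rewrite /q expr_div_n expr2; field.
    rewrite ler_wpM2l ?invr_ge0 ?exprn_ge0 // (le_trans (Pm _)) //.
    by rewrite ler_wpM2l ?exprn_ge0.
  have [V AV VS] := neumann cA A1 AS q0 q1 Sq.
  have SE : 1 - S = (- N ^- 2) *: (P * P) + 1 by rewrite scaleNr addrC.
  have AS1 : A (1 - S) by rewrite SE; apply: AP => //; exact: AM.
  have fVS : f V * (1 - N ^- 2 *: (p * p)) = 1.
    rewrite -[RHS]f1 -VS fM // SE fl ?f1 //; last exact: AM.
    by rewrite fM // scaleNr addrC.
  have [c0 c00 cV] := op_pos_bound (f V).
  pose c := c0 + 1; have c1 : 1 <= c by rewrite lerDr.
  have cgt0 : 0 < c by rewrite (lt_le_trans ltr01).
  have ck y : `|y| <= c * `|y - N ^- 2 *: p (p y)|.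
    have {1}-> : y = f V (y - N ^- 2 *: p (p y)).
      by rewrite -[LHS]/((1 : bounded_op K) y) -fVS.
    by rewrite (le_trans (cV _)) // ler_wpM2r // lerDl.
  have dist y : `|y - N ^- 2 *: p (p y)| ^+ 2 <= `|y| ^+ 2 - N ^- 2 * `|p y| ^+ 2.
    have -> : `|y - N ^- 2 *: p (p y)| ^+ 2
        = `|y| ^+ 2 - 2 * N ^- 2 * `|p y| ^+ 2 + N ^- 4 * `|p (p y)| ^+ 2.
      have NJ : (N ^- 2)^* = N ^- 2 by rewrite geC0_conj // invr_ge0 exprn_ge0.
      rewrite -!inner_norm !(innerDl, innerDr, innerNl, innerNr, innerZl, innerZr).
      by rewrite NJ -[inner y (p (p y))]psa [inner (p (p y)) y]psa; field.
    have : `|p (p y)| ^+ 2 <= N ^+ 2 * `|p y| ^+ 2.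
      by rewrite -exprMn ler_sqr ?nnegrE ?mulr_ge0.
    move=> /(ler_wpM2l (_ : 0 <= N ^- 4)); rewrite invr_ge0 exprn_ge0 // => /(_ isT) le4.
    apply: le_trans (lerD (lexx _) le4) _.
    rewrite le_eqVlt; apply/orP; left; apply/eqP; field.
    exact: Nn0.
  pose L := N ^+ 2 * (1 - c ^- 2).
  have L0 : 0 <= L.
    rewrite mulr_ge0 ?exprn_ge0 // subr_ge0 invf_le1 ?exprn_gt0 //.
    by rewrite exprn_ege1.
  have pL y : `|p y| <= sqrtC L * `|y|.
    rewrite -ler_sqr ?nnegrE ?mulr_ge0 ?sqrtC_ge0 // exprMn sqrtCK.
    have le1 : `|y| ^+ 2 <= c ^+ 2 * (`|y| ^+ 2 - N ^- 2 * `|p y| ^+ 2).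
      apply: (@le_trans _ _ ((c * `|y - N ^- 2 *: p (p y)|) ^+ 2)).
        by rewrite ler_sqr ?nnegrE ?mulr_ge0 // ltW.
      by rewrite exprMn ler_wpM2l ?exprn_ge0 // ltW.
    have NC : 0 <= N ^+ 2 / c ^+ 2 by rewrite divr_ge0 ?exprn_ge0 // ltW.
    have := ler_wpM2l NC le1; rewrite -subr_ge0 => le2.
    rewrite -subr_ge0; apply: le_trans le2 _.
    rewrite le_eqVlt; apply/orP; left.
    apply/eqP; rewrite /L; field.
    by rewrite Nn0 gt_eqF.
  have := Nmin _ (_ : 0 <= sqrtC L) pL; rewrite sqrtC_ge0 => /(_ L0).
  rewrite -ler_sqr ?nnegrE ?sqrtC_ge0 // sqrtCK /L mulrBr mulr1 lerBrDr.
  rewrite gerDl => /le_lt_trans /(_ (_ : 0 < N ^+ 2 * c ^- 2)).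
  by rewrite ltxx mulr_gt0 ?invr_gt0 ?exprn_gt0 // => /(_ isT).
move=> y; rewrite -ler_sqr ?nnegrE ?mulr_ge0 // exprMn -[leLHS]inner_norm.
have e : inner (f T y) (f T y) = inner y (p y) by rewrite adjointP pE.
rewrite e -[leLHS]ger0_norm -?e ?inner_ge0 // e.
apply: le_trans (inner_CauchySchwarz _ _) _.
rewrite expr2 mulrCA -expr2 ler_wpM2l //; apply: le_trans (pN y) _.
by rewrite ler_wpM2r.
Qed.

Section GeneratedCstar.
Variables (R : realType) (H : hilbertType R) (M : set (bounded_op H)).

Lemma generated_cstar_subset : M `<=` generated_cstar M.
Proof. exact: sub_smallest. Qed.

Lemma generated_cstarP : cstar_subalgebra (generated_cstar M).
Proof.
split; first split.
- by move=> A [[[]]].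
- move=> a S T AS AT A cA; have [[[_ AP] _ _ _] _] := cA.
  by apply: AP; [exact: AS|exact: AT].
- move=> S T AS AT A cA; have [[_ AM _ _] _] := cA.
  by apply: AM; [exact: AS|exact: AT].
- by move=> T AT A cA; have [[_ _ AJ _] _] := cA; apply: AJ; exact: AT.
- move=> T TA A cA; have [[_ _ _ Acl] _] := cA; apply: Acl => e /TA [S AS ST].
  by exists S => //; exact: AS.
Qed.

End GeneratedCstar.

Section RepSum.
Variables (R : realType) (H : hilbertType R) (M : set (bounded_op H)).
Variables (I : choiceType) (K : I -> hilbertType R).
Variable pi : forall i, bounded_op H -> bounded_op (K i).
Hypothesis M_unital : unital_operator_space M.
Hypothesis pi_rep : forall i, star_representation (generated_cstar M) (pi i).

Let A1 : generated_cstar M 1.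
Proof. by apply: generated_cstar_subset; case: M_unital. Qed.

Lemma rep_sum_bounded t : generated_cstar M t ->
  uniformly_bounded (fun i => pi i t).
Proof.
move=> At; have [m m0 tm] := op_pos_bound t; exists m => i.
exact: (rep_contractive (generated_cstarP M) A1 (pi_rep i) At m0 tm).
Qed.

Lemma rep_sumE t (f : hilbert_sum K) i :
  generated_cstar M t -> rep_sum pi t f i = pi i t (f i).
Proof. by move=> At; exact: (op_sumE _ _ (rep_sum_bounded At)). Qed.

Lemma rep_sum_star_representation :
  star_representation (generated_cstar M) (rep_sum pi).
Proof.
have [[_ AP] AM AJ _] := generated_cstarP M.
split.
- move=> a S T AS AT; apply: opP => f; apply: hsumP => i.
  rewrite rep_sumE; last exact: AP.
  rewrite [RHS]/(a *: rep_sum pi S f i + rep_sum pi T f i) !rep_sumE //.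
  by rewrite (rep_linear (pi_rep i)).
- apply: opP => f; apply: hsumP => i.
  by rewrite rep_sumE // (rep1 (pi_rep i)).
- move=> S T AS AT; apply: opP => f; apply: hsumP => i.
  rewrite rep_sumE; last exact: AM.
  have -> : (rep_sum pi S * rep_sum pi T) f i = rep_sum pi S (rep_sum pi T f) i by [].
  rewrite (rep_sumE _ _ AS) (rep_sumE _ _ AT).
  by rewrite (repM (pi_rep i)).
- move=> T AT; apply: opP => g; apply: inner_inj => f; rewrite -adjointP.
  rewrite -[LHS]/(hsum_inner _ _) -[RHS]/(hsum_inner _ _) /hsum_inner.
  congr (summability.sum (_ : I -> R[i]^o)); apply/funext => i.
  rewrite !rep_sumE //; last exact: AJ.
  by rewrite (rep_adjoint (pi_rep i)) // adjointP.
Qed.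

End RepSum.

(* Main.v *)
Require Import Defs.
From mathcomp Require Import all_boot all_order all_algebra.
From mathcomp Require Import boolp classical_sets reals topology normedtype.
From mathcomp Require Import finmap complex ring.
From mathcomp.analysis.showcase Require Import summability.

(* If psi is ucp and agrees with the direct sum pi on M, its compression psi_i
   to K_i agrees with pi_i on M, so there are unitaries u_i, indexed by a net
   depending on i, with u_i* psi_i u_i -> pi_i weakly. Let u be the direct sum
   of the u_i, indexed by the product net. For x in K_i and w := u* psi(t) u x,
   the Kadison-Schwarz inequality gives
     |w|^2 = |psi(t) u_i x|^2 <= <psi_i(t* t) u_i x, u_i x>
       -> <pi_i(t* t) x, x> = |pi_i(t) x|^2,
   while <w, pi_i(t) x> -> |pi_i(t) x|^2. Hence w -> pi_i(t) x in norm; this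
   also kills the off-diagonal blocks of psi. As the u* psi(t) u are uniformly
   bounded, the convergence is strong on the whole sum, a fortiori weak. *)

Set Implicit Arguments.
Unset Strict Implicit.
Unset Printing Implicit Defensive.
Import Order.TTheory GRing.Theory Num.Theory.
Import numFieldNormedType.Exports.
Local Open Scope classical_set_scope.
Local Open Scope ring_scope.

(** * Norm limits from inner products, unitaries and Gram matrices *)

Section Hilbert.
Variables (R : realType) (H : hilbertType R).

Lemma normB_sqr (x y : H) :
  `|x - y| ^+ 2 = `|x| ^+ 2 - (inner x y + (inner x y)^*) + `|y| ^+ 2.
Proof.
rewrite -!inner_norm innerDl !innerDr !innerNl !innerNr opprK [inner y x]innerC.
by ring.
Qed.

(** Expanding the square, [|w b - x| ^+ 2] is at most [c b] minus twice the real part of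
    [inner (w b) x] plus [|x| ^+ 2], which tends to 0. A convergent upper bound for [|w b| ^+ 2] is
    enough, and Kadison-Schwarz supplies just that. *)
Lemma cvg_norm_of_inner (B : Type) (F : set_system B) (FF : ProperFilter F)
    (w : B -> H) (c : B -> R[i]^o) (x : H) :
  (forall b, `|w b| ^+ 2 <= c b) -> c @ F --> (`|x| ^+ 2 : R[i]^o) ->
  (inner (w b) x : R[i]^o) @[b --> F] --> (`|x| ^+ 2 : R[i]^o) ->
  w @ F --> x.
Proof.
move=> wc cx wx; apply/cvgrPdist_lt => e e0.
have x2J : (`|x| ^+ 2)^* = `|x| ^+ 2 by rewrite geC0_conj // exprn_ge0.
have : (c b - (inner (w b) x + (inner (w b) x)^*) + `|x| ^+ 2 : R[i]^o) @[b --> F]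
    --> (`|x| ^+ 2 - (`|x| ^+ 2 + (`|x| ^+ 2)^*) + `|x| ^+ 2 : R[i]^o).
  exact: (cvgD (cvgB cx (cvgD wx (cvg_conjC _ wx))) (cvg_cst _)).
rewrite x2J opprD addNKr addNr => /cvgrPdist_lt /(_ (e ^+ 2)).
rewrite exprn_gt0 // => /(_ isT) lim0; near=> b.
rewrite distrC -ltr_sqr ?nnegrE // ?(ltW e0) //.
have le1 : `|w b - x| ^+ 2 <= c b - (inner (w b) x + (inner (w b) x)^*) + `|x| ^+ 2.
  by rewrite normB_sqr !lerD2r.
apply: (le_lt_trans le1); rewrite -[ltLHS]ger0_norm; last first.
  by apply: le_trans le1; rewrite exprn_ge0.
by rewrite -(normrN (_ + _)) -(sub0r (_ + `|x| ^+ 2)); near: b; exact: lim0.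
Unshelve. all: by end_near. Qed.

Lemma cvg_innerl (B : Type) (F : set_system B) (FF : ProperFilter F)
    (w : B -> H) (x y : H) :
  w @ F --> x -> (inner (w b) y : R[i]^o) @[b --> F] --> (inner x y : R[i]^o).
Proof.
move=> /cvgrPdist_lt wx; apply/cvgrPdist_lt => e e0.
have y0 : 0 < `|y| + 1 by rewrite ltr_wpDl.
have := wx _ (divr_gt0 e0 y0) => {}wx; near=> b.
rewrite -innerNl -innerDl; apply: le_lt_trans (inner_CauchySchwarz _ _) _.
apply: (@le_lt_trans _ _ (`|x - w b| * (`|y| + 1))).
  by rewrite ler_wpM2l // lerDl.
by rewrite -ltr_pdivlMr //; near: b; exact: wx.
Unshelve. all: by end_near. Qed.

Lemma adjoint1 : adjoint (1 : bounded_op H) = 1.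
Proof. by apply: opP => y; apply: inner_inj => x; rewrite -adjointP. Qed.

Lemma inner_adjointl (T : bounded_op H) x y :
  inner (adjoint T x) y = inner x (T y).
Proof. by rewrite innerC -adjointP -innerC. Qed.

Lemma op_conjE (S V : bounded_op H) x :
  (adjoint V * S * V) x = adjoint V (S (V x)).
Proof. by []. Qed.

Lemma unitary_norm (u : bounded_op H) x : unitary u -> `|u x| = `|x|.
Proof.
move=> [uu _]; apply/eqP; rewrite -(@eqrXn2 _ 2) // -!inner_norm adjointP.
by rewrite -[adjoint u (u x)]/((adjoint u * u) x) uu.
Qed.

Lemma unitary_adjoint_norm (u : bounded_op H) x :
  unitary u -> `|adjoint u x| = `|x|.
Proof.
move=> [_ uu]; apply/eqP; rewrite -(@eqrXn2 _ 2) // -!inner_norm -adjointP.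
by rewrite -[u (adjoint u x)]/((u * adjoint u) x) uu.
Qed.

(** The form at [x] is the squared norm of [s], the sum of the [r i (x i)]. *)
Lemma mx_positive_gram n (r : 'I_n -> bounded_op H) :
  mx_positive (\matrix_(i, j) (adjoint (r i) * r j)).
Proof.
move=> x; pose s := \sum_(i < n) r i (x i).
have sumr y : inner s y = \sum_(j < n) inner (r j (x j)) y.
  exact: (big_morph (fun v => inner v y) (fun a b => innerDl a b y) (inner0l y)).
suff -> : \sum_i \sum_j inner ((\matrix_(i, j) (adjoint (r i) * r j)) i j (x j)) (x i)
    = inner s s by exact: inner_ge0.
have E i j : inner ((\matrix_(i, j) (adjoint (r i) * r j)) i j (x j)) (x i)
    = inner (r j (x j)) (r i (x i)).
  by rewrite mxE [LHS]innerC -[inner (x i) _]/(inner (x i) (adjoint (r i) _)) -adjointP -innerC.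
under eq_bigr do under eq_bigr do rewrite E.
under eq_bigr do rewrite -sumr innerC.
by rewrite [RHS]innerC sumr rmorph_sum.
Qed.

End Hilbert.

(** * Schwarz inequality for completely positive maps *)

Lemma kadison_schwarz (R : realType) (H K : hilbertType R)
    (A : set (bounded_op H)) (f : bounded_op H -> bounded_op K) t x :
  cstar_subalgebra A -> A 1 -> unital_completely_positive A f -> A t ->
  `|f t x| ^+ 2 <= inner (f (adjoint t * t) x) x.
Proof.
move=> [_ AM AJ _] A1 [_ f1 fpos] At.
(* Apply f to the positive matrix [t* t, t*; t, 1] and test on (x, y). *)
pose r (i : 'I_2) : bounded_op H := if i == ord0 then t else 1.
have pos y : 0 <= inner (f (adjoint t * t) x) x + inner (f (adjoint t) y) x
    + (inner (f t x) y + inner y y).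
  have Ag i j : A ((\matrix_(i, j) (adjoint (r i) * r j)) i j).
    by rewrite mxE /r; apply: AM; [apply: AJ|]; case: ifP.
  have := fpos _ _ Ag (mx_positive_gram r) (fun i => if i == ord0 then x else y).
  rewrite !big_ord_recl !big_ord0 !mxE /r /= !addr0 adjoint1 mul1r mulr1 mulr1 f1.
  exact.
pose a := inner (f (adjoint t * t) x) x.
have a0 : 0 <= a.
  have := pos 0; rewrite linear0 [inner (f t x) 0]innerC !inner0l conjC0.
  by rewrite !addr0.
have aJ : a^* = a := geC0_conj a0.
have sqrJ (z : K) : (`|z| ^+ 2)^* = `|z| ^+ 2 by rewrite geC0_conj ?exprn_ge0.
(* Nonnegative numbers are real; y and 'i y together give f t* = (f t)*. *)
have cross y : inner (f (adjoint t) y) x = (inner (f t x) y)^*.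
  set p := inner _ x; set q := inner _ y.
  have pq : p^* + q^* = p + q.
    have := geC0_conj (pos y); rewrite -/a -/p -/q inner_norm !rmorphD /= aJ sqrJ => E.
    have -> : p^* + q^* = (a + p^* + (q^* + `|y| ^+ 2)) - a - `|y| ^+ 2 by ring.
    by rewrite E; ring.
  have ipq : 'i * q^* - 'i * p^* = 'i * p - 'i * q.
    have := geC0_conj (pos ('i *: y)); rewrite linearZ innerZl innerZr conjCi.
    rewrite -/a -/p -/q inner_norm !rmorphD /= !sqrJ !rmorphM rmorphN /= !conjCi.
    rewrite aJ => E.
    set N := `|_| ^+ 2 in E.
    have -> : 'i * q^* - 'i * p^* = (a + - 'i * p^* + (- - 'i * q^* + N)) - a - N by ring.
    by rewrite E; ring.
  have {}ipq : q^* - p^* = p - q.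
    by apply: (mulfI (neq0Ci R[i])); rewrite !mulrBr.
  apply: (@mulfI _ 2); rewrite ?pnatr_eq0 //.
  have -> : 2 * p = (p + q) + (p - q) by ring.
  by rewrite -pq -ipq; ring.
(* At [y = - f t x] the last two terms of [pos] cancel and, by [cross], the second one is minus
   [|f t x| ^+ 2]. *)
have := pos (- f t x); rewrite linearN innerNl cross innerNr innerNl innerNr.
rewrite opprK inner_norm sqrJ addNr addr0 subr_ge0 //.
Qed.

(** * Summands, diagonal operators and compressions of a Hilbert sum *)

Section HilbertSumTheory.
Variables (R : realType) (I : choiceType) (K : I -> hilbertType R).
Implicit Types f g : hilbert_sum K.

Lemma dfwith0_summable i (x : K i) : square_summable (dfwith (fun j => 0 : K j) x).
Proof.
exists (`|x| ^+ 2) => A; have [iA|iA] := boolP (i \in A).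
  rewrite (big_fsetD1 i) //= dfwith_in big_seq_cond big1 ?addr0 // => j.
  by rewrite andbT !inE => /andP[ji _]; rewrite dfwith_out 1?eq_sym // normr0 expr0n.
rewrite big_seq_cond big1 ?exprn_ge0 // => j; rewrite andbT => jA.
rewrite dfwith_out ?normr0 ?expr0n //.
by apply: contraNneq iA => ->.
Qed.

Definition hsum_inj i (x : K i) : hilbert_sum K := HilbertSum (dfwith0_summable x).

Lemma hsum_inj_same i (x : K i) : hsum_inj x i = x.
Proof. exact: dfwith_in. Qed.

Lemma hsum_inj_diff i (x : K i) j : i != j -> hsum_inj x j = 0.
Proof. by move=> ij; exact: dfwith_out. Qed.

Lemma hsum_inj_linear i : linear (@hsum_inj i).
Proof.
move=> a x y; apply: hsumP => j; rewrite hsumDE hsumZE.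
have [<-|ij] := eqVneq i j; first by rewrite !hsum_inj_same.
by rewrite !hsum_inj_diff // scaler0 addr0.
Qed.

(** The i-th coordinate map is the adjoint of the inclusion: the partial sums are constant once the
    finite set contains [i]. *)
Lemma inner_hsum_inj i (x : K i) f : inner (hsum_inj x) f = inner x (f i).
Proof.
refine (@cvg_unique R[i]^o (@norm_hausdorff _ R[i]^o) _ _ _ _ (@cvg_hsum_inner _ _ _ _ _) _).
apply: cvg_near_cst; exists [fset i]%fset => // A /= /fsubsetP iA.
have {}iA : i \in A by apply: iA; rewrite inE.
rewrite partial_sumE (big_fsetD1 i) //= dfwith_in big_seq_cond big1 ?addr0 // => j.
by rewrite andbT !inE => /andP[ji _]; rewrite dfwith_out 1?eq_sym // inner0l.
Qed.

Lemma hsum_inj_norm i (x : K i) : `|hsum_inj x| = `|x|.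
Proof.
apply/eqP; rewrite -(@eqrXn2 _ 2) // -!inner_norm inner_hsum_inj.
by rewrite hsum_inj_same.
Qed.

(** Pythagoras: the squared distance from [f] to its truncation is [|f| ^+ 2] minus a partial sum of
    the squares, and these partial sums converge to [|f| ^+ 2]. *)
Lemma hsum_inj_approx f (e : R[i]) : 0 < e ->
  exists A : {fset I}, `|f - \sum_(i <- A) hsum_inj (f i)| < e.
Proof.
move=> e0; pose s (A : {fset I}) := \sum_(i <- A) hsum_inj (f i).
have sE A i : i \in A -> s A i = f i.
  move=> iA; apply: inner_inj => x; rewrite -inner_hsum_inj innerC.
  rewrite /s (big_morph (fun v => inner v _) (fun a b => innerDl a b _) (inner0l _)).
  rewrite (big_fsetD1 i) //= inner_hsum_inj hsum_inj_same big_seq_cond big1; last first.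
    move=> j; rewrite andbT !inE => /andP[ji _].
    by rewrite inner_hsum_inj hsum_inj_diff 1?eq_sym // innerC inner0l conjC0.
  by rewrite addr0 -innerC.
have sinner A g : (forall i, i \in A -> g i = f i) ->
    inner (s A) g = \sum_(i <- A) `|f i| ^+ 2.
  move=> gf.
  rewrite /s (big_morph (fun v => inner v _) (fun a b => innerDl a b _) (inner0l _)).
  rewrite big_seq [RHS]big_seq; apply: eq_bigr => i iA.
  by rewrite inner_hsum_inj gf // inner_norm.
have dist A : `|f - s A| ^+ 2 = `|f| ^+ 2 - \sum_(i <- A) `|f i| ^+ 2.
  rewrite normB_sqr -(inner_norm (s A)) (sinner A (s A)); last by move=> i; exact: sE.
  rewrite [inner f _]innerC conjCK (sinner A f) //.
  rewrite geC0_conj; last by apply: sumr_ge0 => i _; exact: exprn_ge0.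
  by ring.
have := @cvg_hsum_inner _ _ _ f f.
move=> /cvgrPdist_lt /(_ (e ^+ 2)); rewrite exprn_gt0 // => /(_ isT) [A _ /(_ A)] /=.
move=> /(_ (fsubset_refl A)); rewrite partial_sumE hsum_norm_sqr.
under eq_bigr do rewrite inner_norm.
move=> ltA.
exists A; rewrite -ltr_sqr ?nnegrE ?(ltW e0) // dist.
apply: le_lt_trans ltA.
by rewrite ger0_norm // -dist exprn_ge0.
Qed.

(** Finite sums of included vectors are dense and the operators share a bound, so an e/2 argument
    passes from the summands to the whole sum. *)
Lemma hsum_strong_cvg (B : Type) (F : set_system B) (FF : ProperFilter F)
    (T_ : B -> bounded_op (hilbert_sum K)) (T : bounded_op (hilbert_sum K)) (m : R[i]) :
  (forall b f, `|T_ b f| <= m * `|f|) ->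
  (forall i (x : K i), T_ b (hsum_inj x) @[b --> F] --> T (hsum_inj x)) ->
  forall f, T_ b f @[b --> F] --> T f.
Proof.
move=> Tm Tx f; have [n n0 Tn] := op_pos_bound T.
have {}Tm b g : `|T_ b g| <= `|m| * `|g|.
  rewrite -[X in _ * X]normr_id -normrM (le_trans (Tm b g)) // real_ler_norm //.
  exact: ger0_real (le_trans (normr_ge0 _) (Tm b g)).
have Tsum (A : {fset I}) : T_ b (\sum_(i <- A) hsum_inj (f i)) @[b --> F]
    --> T (\sum_(i <- A) hsum_inj (f i)).
  rewrite raddf_sum /=; under eq_fun do rewrite raddf_sum /=.
  apply: cvg_big => [|i _]; [exact: add_continuous|exact: Tx].
(* [|m| + n] bounds [T - T_ b] for every [b]; the added 1 makes the divisor positive. *)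
apply/cvgrPdist_lt => e e0; pose c := `|m| + n + 1.
have c0 : 0 < c by rewrite ltr_wpDl // addr_ge0.
have [A fA] := hsum_inj_approx f (divr_gt0 (divr_gt0 e0 (ltr0n _ 2)) c0).
have /cvgrPdist_lt /(_ _ (divr_gt0 e0 (ltr0n _ 2))) TA := Tsum A.
set s := \sum_(i <- A) _ in fA TA; near=> b.
have -> : T f - T_ b f = (T (f - s) - T_ b (f - s)) + (T s - T_ b s).
  rewrite (linearB T) (linearB (T_ b)) opprB.
  by rewrite [T_ b s - _]addrC addrACA subrK addrK.
rewrite (le_lt_trans (ler_normD _ _)) // [ltRHS]splitr ler_ltD //; last first.
  by near: b; exact: TA.
rewrite (le_trans (ler_normB _ _)) // (le_trans (lerD (Tn _) (Tm _ _))) //.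
rewrite -mulrDl (@le_trans _ _ (c * `|f - s|)) //.
  by rewrite ler_wpM2r // /c [n + _]addrC lerDl.
by rewrite mulrC -ler_pdivlMr // ltW.
Unshelve. all: by end_near. Qed.

Lemma adjoint_op_sum (T : forall i, bounded_op (K i)) :
  uniformly_bounded T -> uniformly_bounded (fun i => adjoint (T i)) ->
  adjoint (op_sum T) = op_sum (fun i => adjoint (T i)).
Proof.
move=> Tb Tb'; apply: opP => g; apply: inner_inj => f; rewrite -adjointP.
rewrite -[LHS]/(hsum_inner _ _) -[RHS]/(hsum_inner _ _) /hsum_inner.
congr (summability.sum (_ : I -> R[i]^o)); apply/funext => i.
by rewrite !op_sumE // adjointP.
Qed.

(** [op_sum] is 0 on families that are not uniformly bounded, so computing its coordinates with
    [op_sumE] asks for this bound. *)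
Lemma unitary_uniformly_bounded (u : forall i, bounded_op (K i)) :
  (forall i, unitary (u i)) -> uniformly_bounded u.
Proof. by move=> uu; exists 1 => i x; rewrite unitary_norm // mul1r. Qed.

Lemma unitary_adjoint_uniformly_bounded (u : forall i, bounded_op (K i)) :
  (forall i, unitary (u i)) -> uniformly_bounded (fun i => adjoint (u i)).
Proof. by move=> uu; exists 1 => i x; rewrite unitary_adjoint_norm // mul1r. Qed.

Lemma unitary_op_sum (u : forall i, bounded_op (K i)) :
  (forall i, unitary (u i)) -> unitary (op_sum u).
Proof.
move=> uu; have ub := unitary_uniformly_bounded uu.
have ub' := unitary_adjoint_uniformly_bounded uu.
rewrite /unitary adjoint_op_sum //; split; apply: opP => f; apply: hsumP => i.
  rewrite -[LHS]/(op_sum (fun i => adjoint (u i)) (op_sum u f) i) !op_sumE //.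
  by rewrite -[LHS]/((adjoint (u i) * u i) (f i)); have [-> _] := uu i.
rewrite -[LHS]/(op_sum u (op_sum (fun i => adjoint (u i)) f) i) !op_sumE //.
by rewrite -[LHS]/((u i * adjoint (u i)) (f i)); have [_ ->] := uu i.
Qed.

Lemma op_sum_inj (T : forall i, bounded_op (K i)) i (x : K i) :
  uniformly_bounded T -> op_sum T (hsum_inj x) = hsum_inj (T i x).
Proof.
move=> Tb; apply: hsumP => j; rewrite op_sumE //.
have [<-|ij] := eqVneq i j; first by rewrite !hsum_inj_same.
by rewrite !hsum_inj_diff // linear0.
Qed.

Section Compression.
Variables (T : bounded_op (hilbert_sum K)) (i : I).

Lemma compression_linear : linear (fun x : K i => T (hsum_inj x) i).
Proof. by move=> a x y; rewrite hsum_inj_linear linearP. Qed.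

Lemma compression_bounded : bounded_map (fun x : K i => T (hsum_inj x) i).
Proof.
have [m Tm] := op_bounded T; exists m => x.
by rewrite (le_trans (hsum_norm_coord _ _)) // (le_trans (Tm _)) // hsum_inj_norm.
Qed.

(** The diagonal block V* T V, where V is the inclusion [hsum_inj] of [K i]. *)
Definition compression := BoundedOp compression_linear compression_bounded.

Lemma inner_compression x y :
  inner (compression x) y = inner (T (hsum_inj x)) (hsum_inj y).
Proof. by rewrite innerC [RHS]innerC inner_hsum_inj. Qed.

End Compression.

(** The form of the compressed matrix at [x] is the form of the uncompressed one at the vectors
    [hsum_inj (x j)]. *)
Lemma compression_ucp (H : hilbertType R) (A : set (bounded_op H))
    (psi : bounded_op H -> bounded_op (hilbert_sum K)) i :
  unital_completely_positive A psi ->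
  unital_completely_positive A (fun t => compression (psi t) i).
Proof.
move=> [psil psi1 psip]; split=> [a S T AS AT||n a Aa a0 x].
- by apply: opP => x; rewrite /= psil.
- by apply: opP => x; rewrite /= psi1 hsum_inj_same.
have := psip n a Aa a0 (fun j => hsum_inj (x j)).
congr (0 <= _); apply: eq_bigr => j _; apply: eq_bigr => k _.
by rewrite !mxE inner_compression.
Qed.

End HilbertSumTheory.

(** * Products of directed sets *)

Section ProductNet.
Variables (I : eqType) (B : I -> Type) (le : forall i, B i -> B i -> Prop).
Hypothesis le_directed : forall i, directed (@le i).

Definition product_le (b c : forall i, B i) : Prop := forall i, le (b i) (c i).

Lemma product_directed : directed product_le.
Proof.
split=> [|b i|a b c ab bc i|a b].
- by constructor=> i; exact: (inhabited_witness (directed_inhabited (le_directed i))).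
- by case: (le_directed i).
- by case: (le_directed i) => _ _ tr _; exact: tr (ab i) (bc i).
have ub i : exists c, le (a i) c /\ le (b i) c by case: (le_directed i).
exists (fun i => sval (cid (ub i))).
by split=> i; case: (svalP (cid (ub i))).
Qed.

(** Turns a limit along the i-th net into a limit along the product net. *)
Lemma product_tails_proj i : (fun b => b i) @ tails product_le --> tails (@le i).
Proof.
move=> X [b _ bX]; have [[b0] lexx _ _] := product_directed.
(* This point has coordinate [b] at [i] and the arbitrary [b0] elsewhere; its tail projects into the
   tail of [b]. *)
exists (dfwith b0 b) => // c /(_ i); rewrite dfwith_in; exact: bX.
Qed.

End ProductNet.

(** * Gluing the unitaries of the summands *)

Theorem proposition3p7 (R : realType) (H : hilbertType R)
    (M : set (bounded_op H)) (I : choiceType) (K : I -> hilbertType R)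
    (pi : forall i : I, bounded_op H -> bounded_op (K i)) :
  unital_operator_space M ->
  (forall i : I, star_representation (generated_cstar M) (pi i)) ->
  (forall i : I, approximate_uep M (pi i)) ->
  approximate_uep M (rep_sum pi).
Proof.
move=> Mu pi_rep pi_uep psi psi_ucp psiM.
have cA := generated_cstarP M; have [_ AM AJ _] := cA.
have A1 : generated_cstar M 1 by apply: generated_cstar_subset; case: Mu.
have psi_i i t : M t -> compression (psi t) i = pi i t.
  move=> Mt; apply: opP => x; rewrite /= psiM // (rep_sumE Mu pi_rep) ?hsum_inj_same //.
  exact: generated_cstar_subset.
(* Choice turns the nets, which exist only propositionally and vary with [i], into data from which
   the product index is formed. *)
have net i : {B : Type & {le : B -> B -> Prop & {u : B -> bounded_op (K i) |
    [/\ directed le, forall b, unitary (u b) & forall t, generated_cstar M t ->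
      wot_cvg (tails le)
        (fun b => adjoint (u b) * compression (psi t) i * u b) (pi i t)]}}}.
  have [B /cid[le /cid[u ?]]] := cid (pi_uep i _ (compression_ucp i psi_ucp) (psi_i i)).
  by exists B, le, u.
pose B i := projT1 (net i).
pose le i : B i -> B i -> Prop := projT1 (projT2 (net i)).
pose u i : B i -> bounded_op (K i) := sval (projT2 (projT2 (net i))).
have le_dir i : directed (@le i) by have [] := svalP (projT2 (projT2 (net i))).
have uU i b : unitary (u i b).
  by have [_ unit_i _] := svalP (projT2 (projT2 (net i))); exact: unit_i.
have u_cvg i t : generated_cstar M t -> wot_cvg (tails (@le i))
    (fun b => adjoint (u i b) * compression (psi t) i * u i b) (pi i t).
  by have [_ _ cvg_i] := svalP (projT2 (projT2 (net i))); exact: cvg_i.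
pose U (b : forall i, B i) := op_sum (fun i => u i (b i)).
have UU b : unitary (U b) by apply: unitary_op_sum => i; exact: uU.
have U_inj b i (x : K i) : U b (hsum_inj x) = hsum_inj (u i (b i) x).
  by rewrite /U op_sum_inj //; apply: unitary_uniformly_bounded => j; exact: uU.
have product_dir := product_directed le_dir.
have FF := tails_filter product_dir.
exists (forall i, B i), (product_le le), U; split=> // t At f g.
(* Strong convergence is enough, by continuity of the inner product. *)
apply: cvg_innerl; move: f {g}.
have [m m0 psi_m] := op_pos_bound (psi t).
apply: (@hsum_strong_cvg _ _ _ _ _ _ _ _ m) => [b f|i x].
  by rewrite op_conjE unitary_adjoint_norm // (le_trans (psi_m _)) // unitary_norm.
(* Used twice: with [adjoint t * t] and [x] for the norm bound, then with [t] and [pi i t x] for the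
   inner product. *)
have u_cvg_inner s y : generated_cstar M s ->
    (inner (compression (psi s) i (u i (b i) x)) (u i (b i) y) : R[i]^o)
      @[b --> tails (product_le le)] --> (inner (pi i s x) y : R[i]^o).
  move=> As; under eq_fun do rewrite -inner_adjointl -op_conjE.
  exact: (cvg_comp _ _ (product_tails_proj le_dir (i := i)) (u_cvg i s As x y)).
have At2 : generated_cstar M (adjoint t * t) by apply: AM => //; exact: AJ.
have norm_pi : inner (pi i (adjoint t * t) x) x = `|pi i t x| ^+ 2.
  rewrite (repM (pi_rep i) (AJ _ At) At) (rep_adjoint (pi_rep i) At) -inner_norm.
  exact: (inner_adjointl (pi i t) (pi i t x) x).
rewrite [rep_sum pi t _]op_sum_inj; last exact: (rep_sum_bounded Mu pi_rep At).
apply: (@cvg_norm_of_inner _ _ _ _ _ _ (fun b => inner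
    (compression (psi (adjoint t * t)) i (u i (b i) x)) (u i (b i) x))) => [b||].
- rewrite op_conjE unitary_adjoint_norm // inner_compression U_inj.
  exact: kadison_schwarz cA A1 psi_ucp At.
- by rewrite hsum_inj_norm -norm_pi; exact: u_cvg_inner.
(* The limit vector lies in the i-th summand, so pairing with it sees only the diagonal block of
   [psi t]. *)
under eq_fun do rewrite op_conjE inner_adjointl !U_inj -inner_compression.
by rewrite hsum_inj_norm -inner_norm; exact: u_cvg_inner.
Qed.
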